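(* Let $n$ and $\tau$ be positive integers, let $q\ge 2$ be an integer, and let $h:[-1,1)\to(0,+\infty)$ be absolutely monotone on $[-1,1)$. Let $M$ be an integer with $R(n,\tau)<M\le R(n,\tau+1)$. Then $$\mathcal{L}(n,M,\tau;h)\ \ge\ \begin{cases} M\sum_{i=0}^{k-1}\rho_i h(\alpha_i), & \text{if } \tau=2k-1,\\[4pt] M\sum_{i=0}^{k}\gamma_i h(\beta_i), & \text{if } \tau=2k.\end{cases}$$ Moreover, if $\mathcal{L}(n,M,\tau;h)<\infty$, these bounds cannot be improved by utilizing polynomials $f$ of degree at most $\tau$ satisfying $f(t)\le h(t)$ for every $t\in[-1,1)$; that is, the right-hand side equals the maximum value of $f_0M-f(1)$ over all real polynomials $f$ of degree at most $\tau$ satisfying $f(t)\le h(t)$ for every $t\in[-1,1)$.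
   Context: $\mathbb{H}(n,q)$ is the set of all vectors of length $n$ over $\{0,1,\dots,q-1\}$, $d(x,y)$ is the Hamming distance (the number of coordinates in which $x,y$ differ), and $\langle x,y\rangle:=1-\frac{2d(x,y)}{n}$. A code is a nonempty subset $C\subset\mathbb{H}(n,q)$; its $h$-energy is $E(n,C;h):=\frac{1}{|C|}\sum_{x,y\in C,\,x\ne y}h(\langle x,y\rangle)$. A function $h$ is absolutely monotone on $[-1,1)$ if $h$ and all its derivatives are defined and nonnegative on $[-1,1)$. A $\tau$-design is a code $C\subset\mathbb{H}(n,q)$ with $|C|=M=\lambda q^\tau$ for some positive integer $\lambda$ such that, in the $M\times n$ matrix whose rows are the codewords of $C$, every $M\times\tau$ submatrix contains every element of $\mathbb{H}(\tau,q)$ exactly $\lambda$ times as a row. $\mathcal{L}(n,M,\tau;h):=\min\{E(n,C;h): C\subset\mathbb{H}(n,q)\text{ is a }\tau\text{-design},\ |C|=M\}$, with value $\infty$ if no such design exists. Rao bound: $R(n,2k-1):=q\sum_{i=0}^{k-1}\binom{n-1}{i}(q-1)^i$ and $R(n,2k):=\sum_{i=0}^{k}\binom{n}{i}(q-1)^i$. For a real polynomial $f$, $f_0:=q^{-n}\sum_{z=0}^{n}\binom{n}{z}(q-1)^z f\left(1-\frac{2z}{n}\right)$; for $\deg f\le n$ this is the coefficient $f_0$ in the Krawtchouk expansion $f=\sum_{i=0}^n f_iQ_i^{(n,q)}$, where $Q_i^{(n,q)}(t)=K_i^{(n,q)}(z)/\left((q-1)^i\binom{n}{i}\right)$, $z=n(1-t)/2$,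 $K_i^{(n,q)}(z)=\sum_{j=0}^i(-1)^j(q-1)^{i-j}\binom{z}{j}\binom{n-z}{i-j}$. Nodes and weights (Levenshtein). For $M\in(R(n,2k-1),R(n,2k)]$, the reals $-1<\alpha_0<\alpha_1<\dots<\alpha_{k-1}<1$ and positive numbers $\rho_0,\dots,\rho_{k-1}$ are the uniquely determined numbers such that $f_0=\frac{f(1)}{M}+\sum_{i=0}^{k-1}\rho_if(\alpha_i)$ for every real polynomial $f$ of degree at most $2k-1$. For $M\in(R(n,2k),R(n,2k+1)]$, the reals $-1=\beta_0<\beta_1<\dots<\beta_k<1$ and positive numbers $\gamma_0,\dots,\gamma_k$ are the uniquely determined numbers such that $f_0=\frac{f(1)}{M}+\sum_{i=0}^{k}\gamma_if(\beta_i)$ for every real polynomial $f$ of degree at most $2k$. *)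

(* Defs.v *)
From HB Require Import structures.
From mathcomp Require Import all_boot all_order all_algebra.
From mathcomp Require Import all_classical all_reals all_analysis.

Set Implicit Arguments.
Unset Strict Implicit.
Unset Printing Implicit Defensive.

Import Order.TTheory GRing.Theory Num.Theory.
Import numFieldNormedType.Exports.

Local Open Scope classical_set_scope.
Local Open Scope ring_scope.

Definition hamming_space (n q : nat) : finType := {ffun 'I_n -> 'I_q}.

Definition hamming_dist (n q : nat) (x y : hamming_space n q) : nat :=
  #|[pred i : 'I_n | x i != y i]|.

Definition hamming_ip (R : realType) (n q : nat) (x y : hamming_space n q) : R :=
  1 - 2 * (hamming_dist x y)%:R / n%:R.

Definition energy (R : realType) (n q : nat) (C : {set hamming_space n q})
    (h : R -> R) : R :=
  (#|C|%:R)^-1 *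
  \sum_(x in C) \sum_(y in C | x != y) h (hamming_ip R x y).

(* A choice of tau columns is a strictly increasing c : 'I_tau -> 'I_n. When
   n < tau there is no such c, but then no C is a tau-design either, since
   #|C| <= q ^ n < lambda * q ^ tau (for q >= 2). *)
Definition tau_design (n q tau : nat) (C : {set hamming_space n q}) : Prop :=
  exists lambda : nat,
    [/\ (0 < lambda)%N,
        #|C| = (lambda * q ^ tau)%N
      & forall c : 'I_tau -> 'I_n, {homo c : i j / (i < j)%N} ->
        forall u : hamming_space tau q,
          #|[set x in C | [ffun j => x (c j)] == u]| = lambda].

(* Minimum over a finite set of codes; +oo when the set is empty. *)
Definition min_design_energy (R : realType) (n q M tau : nat) (h : R -> R) :
    \bar R :=
  \big[Order.min/+oo%E]_(C : {set hamming_space n q} |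
      `[< tau_design tau C >] && (#|C| == M)) (energy C h)%:E.

Definition rao_bound (n q tau : nat) : nat :=
  if odd tau then
    (q * \sum_(0 <= i < uphalf tau) 'C(n - 1, i) * (q - 1) ^ i)%N
  else (\sum_(0 <= i < (tau./2).+1) 'C(n, i) * (q - 1) ^ i)%N.

(* For deg f <= n this is the zeroth coefficient of f in the expansion in
   normalized Krawtchouk polynomials; the formula is used for every f. *)
Definition krawtchouk0 (R : realType) (n q : nat) (f : {poly R}) : R :=
  (q%:R ^+ n)^-1 *
  \sum_(0 <= z < n.+1)
    'C(n, z)%:R * (q%:R - 1) ^+ z * f.[1 - 2 * z%:R / n%:R].

Definition levenshtein_quadrature (R : realType) (n q M d m : nat)
    (node weight : 'I_m -> R) : Prop :=
  forall f : {poly R}, (size f <= d.+1)%N ->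
    krawtchouk0 n q f = f.[1] / M%:R + \sum_(i < m) weight i * f.[node i].

Definition levenshtein_odd (R : realType) (n q M k : nat)
    (alpha rho : 'I_k -> R) : Prop :=
  [/\ forall i, -1 < alpha i < 1,
      {homo alpha : i j / (i < j)%N >-> i < j},
      forall i, 0 < rho i
    & levenshtein_quadrature n q M (2 * k - 1) alpha rho].

Definition levenshtein_even (R : realType) (n q M k : nat)
    (beta gamma : 'I_k.+1 -> R) : Prop :=
  [/\ beta ord0 = -1,
      forall i, beta i < 1,
      {homo beta : i j / (i < j)%N >-> i < j},
      forall i, 0 < gamma i
    & levenshtein_quadrature n q M (2 * k) beta gamma].

(* The difference quotient is restricted to A, so the derivative is one-sided
   at an endpoint belonging to A. *)
Definition has_derivative_on (R : realType) (A : set R) (f df : R -> R) : Prop :=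
  forall x, A x ->
    (fun y => (f y - f x) / (y - x)) @ within A (x^') --> df x.

(* g m is the m-th derivative of h on [-1, 1). *)
Definition absolutely_monotone (R : realType) (h : R -> R) : Prop :=
  exists g : nat -> R -> R,
    [/\ forall t : R, t \in `[-1, 1[ -> g 0%N t = h t,
        forall m, has_derivative_on [set` `[-1, 1[] (g m) (g m.+1)
      & forall m (t : R), t \in `[-1, 1[ -> 0 <= g m t].

Definition lp_values (R : realType) (n q M tau : nat) (h : R -> R) : set R :=
  [set krawtchouk0 n q f * M%:R - f.[1] | f in
    [set f : {poly R} | (size f <= tau.+1)%N /\
                        forall t : R, t \in `[-1, 1[ -> f.[t] <= h t]].

Definition is_maximum (R : realType) (A : set R) (b : R) : Prop :=
  A b /\ ubound A b.

(* Main.v *)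
(* A polynomial [f <= h] of degree at most [tau] gives [f_0 M - f(1)] as a lower
   bound for the energy of every [tau]-design of size [M]: such polynomials
   cannot distinguish the design from the whole space, which is checked on
   falling factorials of the number of agreeing coordinates. The quadrature
   rule evaluates this bound as [M * \sum_i w_i f(x_i)], so the best one can do
   is to have [f = h] at the nodes. This is achieved by the polynomial that
   interpolates [h] to first order at the nodes, except for order zero at [-1]:
   by Rolle's theorem [h(t) - f(t)] is a nonnegative derivative of [h], over a factorial,
   times [\prod (t - x_i)^2], with the factor [t + 1] unsquared. *)
Require Import Defs.
From HB Require Import structures.
From mathcomp Require Import all_boot all_order all_algebra.
From mathcomp Require Import all_classical all_reals all_analysis.
From mathcomp Require Import ring lra zify.

Set Implicit Arguments.
Unset Strict Implicit.
Unset Printing Implicit Defensive.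

Import Order.TTheory GRing.Theory Num.Theory.
Import numFieldNormedType.Exports.

Local Open Scope classical_set_scope.
Local Open Scope ring_scope.

(** * One-sided derivatives and Rolle's theorem with multiplicities *)

Lemma has_derivative_on_continuous (R : realType) (A : set R) (f df : R -> R) :
  has_derivative_on A f df -> {within A, continuous f}.
Proof.
move=> fdf; apply/subspace_continuousP => x Ax.
have fx : (fun y => f x + (f y - f x) / (y - x) * (y - x)) @ within A x^' --> f x.
  rewrite -[X in _ --> X]addr0 -(mulr0 (df x)).
  apply: cvgD; first exact: cvg_cst.
  apply: cvgM; first exact: fdf.
  rewrite -(subrr x); apply: cvgB; last exact: cvg_cst.
  by move=> P Px; apply: cvg_within; apply: cvg_within.
apply/cvgrPdist_lt => e e0; move/cvgrPdist_lt/(_ e e0): fx.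
rewrite !near_withinE; apply: filterS => y Hy Ay.
have [->|yx] := eqVneq y x; first by rewrite subrr normr0.
by have := Hy yx Ay; rewrite divfK ?subr_eq0// [f x + _]addrC subrK.
Qed.

(** At an interior point the limit within [A] is an unrestricted one, so Caratheodory's slope
    function, given the value [df x] at [x], is continuous there. *)
Lemma has_derivative_on_is_derive (R : realType) (A : set R) (f df : R -> R)
    (x : R) :
  A° x -> has_derivative_on A f df -> is_derive x 1 f (df x).
Proof.
move=> Ax fdf; apply/is_derive1_caratheodory.
exists (fun z => if z == x then df x else (f z - f x) / (z - x)).
split; last by rewrite eqxx.
  move=> z; case: eqP => [->|/eqP zx]; first by rewrite !subrr mulr0.
  by rewrite divfK// subr_eq0.
apply/continuous_withinNx; rewrite eqxx.
have := fdf x (interior_subset Ax).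
move/cvgrPdist_lt => H; apply/cvgrPdist_lt => e /H.
rewrite !near_withinE => He.
near=> y => yx; rewrite (negbTE yx).
have : A y by near: y.
by move: yx; near: y.
Unshelve. all: by end_near. Qed.

Lemma rolle_itv (R : realType) (a b : R) (F dF : R -> R) (x y : R) :
  {within `[a, b[, continuous F} ->
  (forall z, z \in `]a, b[ -> is_derive z 1 F (dF z)) ->
  a <= x -> x < y -> y < b -> F x = F y ->
  exists2 z, x < z < y & dF z = 0.
Proof.
move=> Fc Fd ax xy yb Fxy.
have sub z : z \in `]x, y[ -> z \in `]a, b[.
  rewrite !in_itv/= => /andP[xz zy].
  by rewrite (le_lt_trans ax xz) (lt_trans zy yb).
have [z zxy||z zxy dz] := @Rolle _ F x y xy _ _ Fxy.
- by have := Fd z (sub z zxy).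
- apply: continuous_subspaceW Fc => z /=; rewrite !in_itv/= => /andP[xz zy].
  by rewrite (le_trans ax xz) (le_lt_trans zy yb).
- exists z; first by move: zxy; rewrite in_itv.
  by case: (Fd z (sub z zxy)) => _ <-; case: dz.
Qed.

(* Zeros are listed with multiplicity at most two; consecutive zeros [x i] and
   [x i.+1] give a zero of the derivative in [[x i, x i.+1]], which is an
   endpoint only when the two coincide. *)
Lemma rolle_double (R : realType) (a b : R) (F dF : R -> R) (N : nat)
    (x : nat -> R) :
  {within `[a, b[, continuous F} ->
  (forall z, z \in `]a, b[ -> is_derive z 1 F (dF z)) ->
  (forall i, (i <= N)%N -> x i \in `[a, b[) ->
  (forall i, (i <= N)%N -> F (x i) = 0) ->
  (forall i, (i < N)%N -> x i <= x i.+1) ->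
  (forall i, (i.+1 < N)%N -> x i < x i.+2) ->
  (forall i, (i < N)%N -> x i = x i.+1 -> dF (x i) = 0) ->
  exists y : nat -> R,
    [/\ forall i, (i < N)%N -> y i \in `[a, b[,
        forall i, (i < N)%N -> dF (y i) = 0
      & forall i, (i.+1 < N)%N -> y i < y i.+1].
Proof.
move=> Fc Fd xab Fx xle xlt dFx.
have /choice[y yP] : forall i, exists z, (i < N)%N ->
    [/\ x i <= z <= x i.+1, dF z = 0
      & z = x i \/ z = x i.+1 -> x i = x i.+1].
  move=> i; have [iN|_] := boolP (i < N)%N; last by exists 0.
  have [xx|xx] := eqVneq (x i) (x i.+1).
    by exists (x i) => _; split; [rewrite -xx lexx|exact: dFx|].
  have xlti : x i < x i.+1 by rewrite lt_neqAle xx xle.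
  have := xab i (ltnW iN); have := xab i.+1 iN.
  rewrite !in_itv/= => /andP[_ xb] /andP[ax _].
  have [|z /andP[xz zx] dz] := rolle_itv Fc Fd ax xlti xb.
    by rewrite !Fx// ltnW.
  exists z => _; split=> //; first by rewrite !ltW.
  by case=> zE; move: xz zx; rewrite zE ltxx.
exists y; split=> i iN.
- have [/andP[xy yx] _ _] := yP i iN.
  have := xab i (ltnW iN); have := xab i.+1 iN.
  rewrite !in_itv/= => /andP[_ xb] /andP[ax _].
  by rewrite (le_trans ax xy) (le_lt_trans yx xb).
- by have [] := yP i iN.
- have [/andP[_ y1] _ E1] := yP i (ltnW iN).
  have [/andP[y2 _] _ E2] := yP i.+1 iN.
  (* If [y i = y i.+1], both equal [x i.+1], which forces [x i = x i.+1 = x i.+2]. *)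
  rewrite lt_neqAle (le_trans y1 y2) andbT; apply/eqP => yy.
  have e1 : y i = x i.+1 by apply/eqP; rewrite eq_le y1 yy y2.
  have := xlt i iN.
  by rewrite (E1 (or_intror e1)) -(E2 (or_introl _)) ?ltxx// -yy.
Qed.

(** Applied to distinct zeros, [rolle_double] costs one zero and returns distinct zeros again, so it
    can be iterated. *)
Lemma rolle_iter (R : realType) (a b : R) (N : nat) (D : nat -> R -> R)
    (x : nat -> R) :
  (forall m, {within `[a, b[, continuous (D m)}) ->
  (forall m z, z \in `]a, b[ -> is_derive z 1 (D m) (D m.+1 z)) ->
  (forall i, (i <= N)%N -> x i \in `[a, b[) ->
  (forall i, (i <= N)%N -> D 0%N (x i) = 0) ->
  (forall i, (i < N)%N -> x i < x i.+1) ->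
  exists2 z, z \in `[a, b[ & D N z = 0.
Proof.
elim: N D x => [|N IHN] D x Dc Dd xab Dx xlt; first by exists (x 0%N); auto.
have [|||y [yab Dy ylt]] := rolle_double (Dc 0%N) (Dd 0%N) xab Dx.
- by move=> i iN; exact/ltW/xlt.
- by move=> i iN; rewrite (lt_trans (xlt i _) (xlt i.+1 _))// ltnW.
- by move=> i iN xx; have := xlt i iN; rewrite {1}xx ltxx.
- exact: (IHN (fun m => D m.+1) y).
Qed.

(** Sorting the list puts the zeros in the form needed by [rolle_double]. It yields [N.+1] distinct
    zeros of [D 1], to which [rolle_iter] applies. *)
Lemma rolle_count (R : realType) (a b : R) (N : nat) (D : nat -> R -> R)
    (s : seq R) :
  (forall m, {within `[a, b[, continuous (D m)}) ->
  (forall m z, z \in `]a, b[ -> is_derive z 1 (D m) (D m.+1 z)) ->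
  size s = N.+2 ->
  {in s, forall z, z \in `[a, b[} ->
  {in s, forall z, D 0%N z = 0} ->
  (forall z, (count_mem z s <= 2)%N) ->
  (forall z, count_mem z s = 2%N -> D 1%N z = 0) ->
  exists2 z, z \in `[a, b[ & D N.+1 z = 0.
Proof.
move=> Dc Dd sN sab Ds s2 ds.
pose t := sort <=%R s.
have tN : size t = N.+2 by rewrite size_sort.
have ts : t =i s by move=> z; rewrite mem_sort.
have tc z : count_mem z t = count_mem z s by apply/permP; rewrite perm_sort.
have tsort : sorted <=%R t by rewrite sort_sorted//; exact: le_total.
pose x := nth 0 t.
have xs i : (i <= N.+1)%N -> x i \in s by move=> iN; rewrite -ts mem_nth// tN.
have xle i : (i < N.+1)%N -> x i <= x i.+1.
  by move=> iN; move/(sortedP 0): tsort; apply; rewrite tN.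
have td i : (i <= N.+1)%N -> drop i t = x i :: drop i.+1 t.
  by move=> iN; rewrite (drop_nth 0)// tN.
have cd z i : (count_mem z (drop i t) <= count_mem z s)%N.
  by rewrite -tc leq_count_subseq// drop_subseq.
have [||||| y [yab Dy ylt]] := @rolle_double _ a b _ _ N.+1 x (Dc 0%N) (Dd 0%N).
- by move=> i /xs; exact: sab.
- by move=> i /xs; exact: Ds.
- exact: xle.
(* If [x i = x i.+2], the sorted list has three equal entries in a row, more than the multiplicity
   allows. *)
- move=> i iN; have iN' := ltnW iN.
  have := xle i iN'; have := xle i.+1 iN => le1 le2.
  rewrite lt_neqAle (le_trans le2 le1) andbT; apply/eqP => e02.
  have e01 : x i.+1 = x i by apply/eqP; rewrite eq_le le2 andbT e02 le1.
  have := leq_trans (cd (x i) i) (s2 (x i)).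
  rewrite (td i (ltnW iN')) (td i.+1 iN') (td i.+2 iN)/= -e02 e01 eqxx.
  by rewrite !addnA.
- move=> i iN e01; apply: ds; apply/eqP; rewrite eqn_leq s2/=.
  apply: leq_trans (cd (x i) i).
  by rewrite (td i (ltnW iN)) (td i.+1 iN)/= -e01 eqxx addnA.
exact: (@rolle_iter _ a b N (fun m => D m.+1) y).
Qed.

(** * Hermite interpolation and its error term *)

(** Newton's scheme: conditions are added one at a time, first the values and then the derivatives,
    each by a multiple of a product that leaves the earlier conditions intact. *)
Lemma hermite_interpolant (F : fieldType) (A B : seq F) (u v : F -> F) :
  uniq A -> uniq B -> {subset B <= A} ->
  exists f : {poly F}, [/\ (size f <= size A + size B)%N,
    {in A, forall a, f.[a] = u a} & {in B, forall b, f^`().[b] = v b}].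
Proof.
move=> uA; elim: B => [|b B IHB] /=.
  move=> _ _; elim: A uA => [_|a A IHA /= /andP[aA /IHA[f [sf fA _]]]].
    by exists 0; rewrite size_poly0.
  pose w := \prod_(z <- A) ('X - z%:P).
  rewrite addn0 in sf.
  have wa : w.[a] != 0 by rewrite -[_ == _]/(root w a) root_prod_XsubC.
  exists (f + ((u a - f.[a]) / w.[a]) *: w); split=> //.
    rewrite (leq_trans (size_polyD _ _))// geq_max addn0.
    by rewrite (leq_trans sf)//= (leq_trans (size_scale_leq _ _))// size_prod_XsubC.
  move=> z; rewrite inE !hornerE => /predU1P[->|zA]; first by rewrite divfK// addrC subrK.
  have /rootP -> : root w z by rewrite root_prod_XsubC.
  by rewrite mulr0 addr0 fA.
case/andP=> bB uB BA.
have bA : b \in A by rewrite BA// mem_head.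
have [|f [sf fA fB]] := IHB uB; first by move=> z zB; rewrite BA// inE zB orbT.
pose PA := \prod_(z <- A) ('X - z%:P); pose PB := \prod_(z <- B) ('X - z%:P).
have PAr z : z \in A -> PA.[z] = 0 by move=> zA; apply/rootP; rewrite root_prod_XsubC.
have wE z : z \in A -> (PA * PB)^`().[z] = PA^`().[z] * PB.[z].
  by move=> zA; rewrite derivM !hornerE PAr// mul0r addr0.
(* [b] is a simple root of [PA * PB], because [A] has no repetition and [b] is not in [B]. *)
have wb : (PA * PB)^`().[b] != 0.
  rewrite wE// mulf_neq0//; last by rewrite -[_ == _]/(root PB b) root_prod_XsubC.
  rewrite /PA (perm_big _ (perm_to_rem bA)) big_cons derivM derivXsubC mul1r.
  rewrite hornerD !hornerM hornerXsubC subrr mul0r addr0.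
  by rewrite -[_ == _]/(root _ b) root_prod_XsubC mem_rem_uniqF.
exists (f + ((v b - f^`().[b]) / (PA * PB)^`().[b]) *: (PA * PB)); split.
- rewrite (leq_trans (size_polyD _ _))// geq_max.
  rewrite (leq_trans sf) ?leq_add2l//= (leq_trans (size_scale_leq _ _))//.
  rewrite (leq_trans (size_polyMleq _ _))// !size_prod_XsubC.
  by rewrite addSn addnS.
- by move=> z zA; rewrite hornerD hornerZ hornerM PAr// mul0r mulr0 addr0 fA.
- move=> z zB; rewrite derivD derivZ hornerD hornerZ.
  have [->|zb] := eqVneq z b; first by rewrite divfK// addrC subrK.
  have zB' : z \in B by move: zB; rewrite inE (negbTE zb).
  rewrite (wE z) ?BA// (fB z)//.
  have /rootP -> : root PB z by rewrite root_prod_XsubC.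
  by rewrite !mulr0 addr0.
Qed.

Lemma derivn_monic (F : comNzRingType) (p : {poly F}) (n : nat) :
  p \is monic -> size p = n.+1 -> p^`(n) = (n`!)%:R%:P.
Proof.
move=> pm sp; apply/polyP => i; rewrite coef_derivn coefC.
case: i => [|i]; last by rewrite nth_default ?mul0rn// sp addnS ltnS leq_addr.
by move/monicP: pm; rewrite /lead_coef sp/= addn0 ffactnn => ->.
Qed.

(** The constant [K] makes [D 0 - f - K w] vanish at [t] as well as at the nodes. It then has one
    zero more than there are conditions, and [rolle_count] gives a zero [xi] of its derivative of
    order [size A + size B]. *)
Lemma hermite_error (R : realType) (a b : R) (D : nat -> R -> R)
    (A B : seq R) (f : {poly R}) (t : R) :
  (forall m, {within `[a, b[, continuous (D m)}) ->
  (forall m z, z \in `]a, b[ -> is_derive z 1 (D m) (D m.+1 z)) ->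
  uniq A -> uniq B -> {subset B <= A} -> (0 < size A)%N ->
  {in A, forall z, z \in `[a, b[} ->
  (size f <= size A + size B)%N ->
  {in A, forall z, f.[z] = D 0%N z} ->
  {in B, forall z, f^`().[z] = D 1%N z} ->
  t \in `[a, b[ -> t \notin A ->
  exists2 xi, xi \in `[a, b[ &
    (D 0%N t - f.[t]) * ((size A + size B)`!)%:R =
    D (size A + size B)%N xi *
      (\prod_(z <- A) (t - z) * \prod_(z <- B) (t - z)).
Proof.
move=> Dc Dd uA uB BA A0 Aab sf fA fB tab tA.
pose PA := \prod_(z <- A) ('X - z%:P); pose PB := \prod_(z <- B) ('X - z%:P).
pose w := PA * PB.
have wt : w.[t] = \prod_(z <- A) (t - z) * \prod_(z <- B) (t - z).
  rewrite hornerM !horner_prod.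
  by congr (_ * _); apply: eq_bigr => z _; rewrite hornerXsubC.
have wt0 : w.[t] != 0.
  rewrite -[_ == _]/(root w t) rootM !root_prod_XsubC negb_or tA/=.
  by apply: contra tA => /BA.
have PAr z : z \in A -> PA.[z] = 0 by move=> zA; apply/rootP; rewrite root_prod_XsubC.
have PBr z : z \in B -> PB.[z] = 0 by move=> zB; apply/rootP; rewrite root_prod_XsubC.
have [N sN] : exists N, (size A + size B = N.+1)%N.
  by case: (size A) A0 => // k _; exists (k + size B)%N; rewrite addSn.
have wm : w \is monic by rewrite monicMl ?monic_prod_XsubC.
have sw : size w = N.+2.
  rewrite size_monicM ?monic_prod_XsubC ?monic_neq0 ?monic_prod_XsubC//.
  by rewrite !size_prod_XsubC addnS addSn/= sN.
pose K := (D 0%N t - f.[t]) / w.[t].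
pose p := f + K *: w.
have [|||||||xi xiab] := @rolle_count _ a b N (fun m z => D m z - (p^`(m)).[z])
    (t :: A ++ B).
- move=> m; have pc : {within `[a, b[, continuous (horner p^`(m))}.
    by apply: continuous_subspaceT => z;
      apply/differentiable_continuous/derivable1_diffP.
  by move=> z; apply: cvgB; [exact: Dc|exact: pc].
- move=> m z zab; have := Dd m z zab => dz.
  by rewrite derivnS; apply: is_deriveB.
- by rewrite /= size_cat sN.
- move=> z; rewrite inE mem_cat => /predU1P[->//|/orP[/Aab//|/BA/Aab//]].
- move=> z; rewrite inE mem_cat derivn0 /p hornerD hornerZ => zs.
  apply/eqP; rewrite subr_eq0; apply/eqP.
  case/predU1P: zs => [->|zs]; first by rewrite /K divfK// addrC subrK.
  have zA : z \in A by case/orP: zs => // /BA.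
  by rewrite /w hornerM PAr// mul0r mulr0 addr0 fA.
- move=> z; rewrite /= count_cat !count_uniq_mem//.
  have [<-|_] := eqVneq t z; first by rewrite (negbTE tA) add0n; case: (_ \in _).
  by case: (_ \in _); case: (_ \in _).
(* Multiplicity two means that [z] lies in both [A] and [B]; there [w] has a double root and [f]
   matches the first derivative. *)
- move=> z; rewrite /= count_cat !count_uniq_mem//.
  have [<-|_] := eqVneq t z.
    by rewrite (negbTE tA) (contraNF (@BA t) tA).
  case zA : (z \in A); case zB : (z \in B) => // _.
  rewrite /p derivD derivZ hornerD hornerZ derivM hornerD !hornerM.
  by rewrite PAr// PBr// mulr0 mul0r addr0 mulr0 addr0 fB// subrr.
(* The derivative of order [N.+1] kills [f], by its degree, and turns the monic [w] into a
   factorial. *)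
rewrite derivnD derivnZ (derivn_monic wm sw) derivn_poly0 ?add0r -?sN//.
rewrite hornerZ hornerC => /eqP; rewrite subr_eq0 => /eqP DxiE.
by exists xi => //; rewrite -wt DxiE /K mulrAC divfK// mulrAC divfK.
Qed.

Lemma hermite_interpolant_le (R : realType) (a b : R) (D : nat -> R -> R)
    (A B : seq R) (f : {poly R}) (t : R) :
  (forall m, {within `[a, b[, continuous (D m)}) ->
  (forall m z, z \in `]a, b[ -> is_derive z 1 (D m) (D m.+1 z)) ->
  (forall m z, z \in `[a, b[ -> 0 <= D m z) ->
  uniq A -> uniq B -> {subset B <= A} -> (0 < size A)%N ->
  {in A, forall z, z \in `[a, b[} ->
  (size f <= size A + size B)%N ->
  {in A, forall z, f.[z] = D 0%N z} ->
  {in B, forall z, f^`().[z] = D 1%N z} ->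
  t \in `[a, b[ ->
  0 <= \prod_(z <- A) (t - z) * \prod_(z <- B) (t - z) ->
  f.[t] <= D 0%N t.
Proof.
move=> Dc Dd D0 uA uB BA A0 Aab sf fA fB tab w0.
have [tA|tA] := boolP (t \in A); first by rewrite fA.
have [xi xiab E] := hermite_error Dc Dd uA uB BA A0 Aab sf fA fB tab tA.
rewrite -subr_ge0 -(@pmulr_lge0 _ ((size A + size B)`!)%:R) ?ltr0n ?fact_gt0//.
by rewrite E mulr_ge0// D0.
Qed.

(** * Agreement counts and binomial moments of designs *)

Lemma card_words_agree (n q : nat) (x : hamming_space n q) (J : {set 'I_n}) :
  #|[pred y : hamming_space n q | [forall i in J, y i == x i]]| = (q ^ (n - #|J|))%N.
Proof.
pose F i := [pred a : 'I_q | (i \in J) ==> (a == x i)].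
have -> : #|[pred y : hamming_space n q | [forall i in J, y i == x i]]| =
    #|(family F : simpl_pred {ffun 'I_n -> 'I_q})|.
  apply: eq_card => y; rewrite [LHS]inE; apply/forall_inP/familyP => H i.
    by rewrite inE; apply/implyP/H.
  by move=> iJ; have := H i; rewrite inE iJ.
rewrite card_family foldrE big_map big_enum/= (bigID (mem J))/= big1 ?mul1n.
  rewrite (eq_bigr (fun=> q)); last first.
    move=> i iJ; rewrite -[RHS]card_ord; apply: eq_card => a.
    by rewrite !inE (negbTE iJ).
  rewrite prod_nat_const; congr (_ ^ _)%N.
  have JC : (#|J| + #|[predC J]| = n)%N by rewrite cardC card_ord.
  by rewrite -[X in (X - _)%N]JC addKn; apply: eq_card.
move=> i iJ; rewrite -(card1 (x i)); apply: eq_card => a.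
by rewrite !inE iJ.
Qed.

Lemma subset_card_extend (T : finType) (J : {set T}) (m : nat) :
  (#|J| <= m <= #|T|)%N -> exists2 K : {set T}, J \subset K & #|K| = m.
Proof.
elim: m => [|m IHm]; first by rewrite leqn0 => /andP[/eqP J0 _]; exists J.
case/andP; rewrite leq_eqVlt => /predU1P[Jm _|Jm mT]; first by exists J.
have [|K JK Km] := IHm; first by rewrite -ltnS Jm ltnW.
have /card_gt0P[z] : (0 < #|~: K|)%N by rewrite cardsCs finset.setCK subn_gt0 Km.
rewrite inE => zK; exists (z |: K).
  by rewrite (fintype.subset_trans JK)// finset.subsetUr.
by rewrite cardsU1 zK Km.
Qed.

(** This turns a set of columns into an increasing choice, as [tau_design] demands. *)
Lemma enum_val_ltn (n : nat) (T : {set 'I_n}) :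
  {homo (enum_val : 'I_#|T| -> 'I_n) : i j / (i < j)%N}.
Proof.
move=> i j ij; have x0 := enum_val i.
have ltn_val_trans : transitive (relpre (val : 'I_n -> nat) ltn).
  by move=> b a c; exact: ltn_trans.
rewrite !(enum_val_nth x0).
apply: (sorted_ltn_nth ltn_val_trans) => //; rewrite ?inE -?cardE//.
rewrite /enum_mem -enumT; apply: sorted_filter => //.
by rewrite -sorted_map val_enum_ord iota_ltn_sorted.
Qed.

(** Enlarge [J] to a set [T] of [tau] columns. Exactly [q ^ (tau - #|J|)] rows on [T] agree with [x]
    on [J], and each is the restriction of [lambda] codewords. *)
Lemma design_agree (n q tau : nat) (C : {set hamming_space n q})
    (x : hamming_space n q) (J : {set 'I_n}) :
  tau_design tau C -> (#|J| <= tau <= n)%N ->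
  (#|[set y in C | [forall i in J, y i == x i]]| * q ^ #|J|)%N = #|C|.
Proof.
case=> lambda [_ CE Cc] /andP[Jtau taun].
have [|T JT Ttau] := @subset_card_extend _ J tau; first by rewrite Jtau card_ord.
subst tau.
pose c (i : 'I_#|T|) : 'I_n := enum_val i.
have c_homo : {homo c : i j / (i < j)%N} by exact: enum_val_ltn.
pose J' := c @^-1: J.
have cJ : c @: J' = J.
  apply/setP => z; apply/imsetP/idP => [[i iJ ->]|zJ]; first by move: iJ; rewrite inE.
  have zT := fintype.subsetP JT z zJ.
  have zE : c (enum_rank_in zT z) = z by rewrite /c enum_rankK_in.
  by exists (enum_rank_in zT z); rewrite ?inE ?zE.
have J'J : #|J'| = #|J| by rewrite -cJ card_imset//; exact: enum_val_inj.
pose r (y : hamming_space n q) : hamming_space #|T| q := [ffun j => y (c j)].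
have agr (y : hamming_space n q) :
    [forall i in J, y i == x i] = [forall i in J', r y i == r x i].
  apply/forall_inP/forall_inP => [H i|H z]; first by rewrite !inE !ffunE; exact: H.
  by rewrite -cJ => /imsetP[i iJ ->]; have := H i iJ; rewrite !ffunE.
have -> : #|[set y in C | [forall i in J, y i == x i]]| =
    (q ^ (#|T| - #|J|) * lambda)%N.
  rewrite -J'J -(card_words_agree (r x)) -sum_nat_const.
  rewrite -sum1_card (partition_big r
    [pred u : hamming_space #|T| q | [forall i in J', u i ==  r x i]])/=.
    apply: eq_bigr => u uJ.
    rewrite -(Cc c c_homo u) -sum1_card; apply: eq_bigl => y.
    rewrite !inE agr -/(r y); case: eqP => [->|]; last by rewrite !andbF.
    by rewrite uJ !andbT.
  by move=> y; rewrite !inE agr => /andP[].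
by rewrite CE mulnAC -expnD subnK// mulnC.
Qed.

(** Double counting of the pairs of a codeword [y] and a [j]-set of coordinates on which [y] agrees
    with [x]. *)
Lemma design_binomial_moment (n q tau : nat) (C : {set hamming_space n q})
    (x : hamming_space n q) (j : nat) :
  tau_design tau C -> (j <= tau <= n)%N ->
  (\sum_(y in C) 'C(n - hamming_dist x y, j) * q ^ j = 'C(n, j) * #|C|)%N.
Proof.
move=> Cd jtau.
have binE (y : hamming_space n q) : 'C(n - hamming_dist x y, j) =
    (\sum_(J : {set 'I_n} | #|J| == j) [forall i in J, y i == x i])%N.
  have -> : (n - hamming_dist x y)%N = #|[set i | y i == x i]%SET|.
    rewrite cardsCs card_ord /hamming_dist; congr (n - _)%N.
    by apply: eq_card => i; rewrite !inE eq_sym.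
  rewrite -cards_draws -sum1_card [in RHS]big_mkcond [in LHS]big_mkcond.
  apply: eq_bigr => J _; rewrite inE andbC; case: eqP => //= _.
  have -> : (J \subset [set i | y i == x i]%SET) = [forall i in J, y i == x i].
    by apply/fintype.subsetP/forall_inP => H i /H; rewrite inE.
  by case: ifP.
rewrite (eq_bigr (fun y : hamming_space n q => \sum_(J : {set 'I_n} | #|J| == j)
    [forall i in J, y i == x i] * q ^ j)%N); last first.
  by move=> y _; rewrite binE big_distrl.
rewrite exchange_big/= (eq_bigr (fun=> #|C|)).
  by rewrite sum_nat_const -cardsE card_draws card_ord.
move=> J /eqP Jj; rewrite -(design_agree x Cd (J := J)) ?Jj// -big_distrl/=.
congr (_ * _)%N; rewrite -sum1_card big_mkcond [RHS]big_mkcond.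
by apply: eq_bigr => y _; rewrite inE; case: (y \in C) => //=; case: ifP.
Qed.

(** Both sides count pairs of disjoint subsets of sizes [z] and [j]. Multiplied by the factorials of
    [z], [j] and [n - z - j], each becomes [n!]. *)
Lemma mul_bin_trinomial (n z j : nat) :
  ('C(n, z) * 'C(n - z, j) = 'C(n, j) * 'C(n - j, z))%N.
Proof.
have [zjn|nzj] := leqP (z + j) n; last first.
  have bin0 a b : (n < a + b -> 'C(n, a) * 'C(n - a, b) = 0)%N.
    move=> nab; have [an|na] := leqP a n; last by rewrite bin_small.
    by rewrite [X in (_ * X)%N]bin_small ?muln0// ltn_subLR.
  by rewrite !bin0// addnC.
have zn : (z <= n)%N := leq_trans (leq_addr _ _) zjn.
have jn : (j <= n)%N := leq_trans (leq_addl _ _) zjn.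
have E1 := bin_fact zn; have E2 := bin_fact jn.
have E3 : ('C(n - z, j) * (j`! * (n - z - j)`!) = (n - z)`!)%N
  by apply: bin_fact; rewrite leq_subRL.
have E4 : ('C(n - j, z) * (z`! * (n - j - z)`!) = (n - j)`!)%N
  by apply: bin_fact; rewrite leq_subRL// addnC.
apply/eqP; rewrite -(eqn_pmul2r (fact_gt0 z)) -(eqn_pmul2r (fact_gt0 j)).
rewrite -(eqn_pmul2r (fact_gt0 (n - z - j))); apply/eqP.
transitivity n`!; [rewrite -E1 -E3; ring | rewrite -E2 -E4 -!subnDA addnC; ring].
Qed.

(** The analogue of [design_binomial_moment] for the whole space, with ['C(n, z) * (q - 1) ^ z]
    words at distance [z]. It reduces to the binomial theorem for [(1 + (q - 1)) ^ (n - j)]. *)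
Lemma hamming_binomial_moment (n q j : nat) : (0 < q)%N -> (j <= n)%N ->
  (\sum_(0 <= z < n.+1) 'C(n, z) * (q - 1) ^ z * 'C(n - z, j) * q ^ j =
   'C(n, j) * q ^ n)%N.
Proof.
move=> q0 jn.
rewrite (eq_bigr (fun z => 'C(n, j) * q ^ j * ('C(n - j, z) * (q - 1) ^ z))%N);
  last first.
  move=> z _; rewrite [(_ * 'C(n - z, j))%N]mulnAC mul_bin_trinomial.
  by rewrite -!mulnA; congr (_ * _)%N; rewrite mulnA mulnC.
have -> : (q ^ n = q ^ j * q ^ (n - j))%N by rewrite -expnD subnKC.
rewrite -big_distrr/= -mulnA; congr (_ * (_ * _))%N.
rewrite -[in RHS](subnKC q0) expnDn -(big_mkord predT
  (fun z => 'C(n - j, z) * (1 ^ (n - j - z) * (q - 1) ^ z)))%N.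
(* The terms with [z > n - j] vanish. *)
rewrite (big_cat_nat (n := (n - j).+1))//= ?ltnS ?leq_subr//.
rewrite addnC big_nat big1 ?add0n.
  by apply: eq_bigr => z _; rewrite exp1n mul1n.
by move=> z /andP[jz _]; rewrite bin_small.
Qed.

(** * Polynomial moments in the falling factorial basis *)

(** This is [X (X - 1) ... (X - j + 1)], whose value at a natural number is [j!] times a binomial
    coefficient. *)
Definition falling_poly (R : nzRingType) (j : nat) : {poly R} :=
  \prod_(i <- map (GRing.natmul 1) (iota 0 j)) ('X - i%:P).

Lemma falling_poly_monic (R : nzRingType) (j : nat) : falling_poly R j \is monic.
Proof. exact: monic_prod_XsubC. Qed.

Lemma size_falling_poly (R : nzRingType) (j : nat) : size (falling_poly R j) = j.+1.
Proof. by rewrite size_prod_XsubC size_map size_iota. Qed.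

Lemma horner_falling_poly (R : comNzRingType) (j s : nat) :
  (falling_poly R j).[s%:R] = (s ^_ j)%:R.
Proof.
rewrite /falling_poly; elim: j => [|j IHj]; first by rewrite big_nil hornerC.
rewrite -addn1 iotaD map_cat big_cat/= big_seq1 hornerM IHj hornerXsubC addn1.
(* Truncated [s - j] matches subtraction in [R] only for [j <= s]; otherwise [s ^_ j] is already
   zero. *)
rewrite ffactnSr natrM add0n; have [js|sj] := leqP j s; first by rewrite natrB.
by rewrite ffact_small// !mul0r.
Qed.

(** The identity is linear in [p]. It holds for falling factorials by the two binomial moments, and
    these are monic of every degree, so leading terms can be peeled off. *)
Lemma design_poly_moment (R : realType) (n q tau : nat)
    (C : {set hamming_space n q}) (x : hamming_space n q) (p : {poly R}) :
  tau_design tau C -> (0 < q)%N -> (tau <= n)%N -> (size p <= tau.+1)%N ->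
  \sum_(y in C) p.[(n - hamming_dist x y)%:R] =
  #|C|%:R * ((q%:R ^+ n)^-1 *
    \sum_(0 <= z < n.+1) 'C(n, z)%:R * (q%:R - 1) ^+ z * p.[(n - z)%:R]).
Proof.
move=> Cd q0 taun.
have qn0 m : q%:R ^+ m != 0 :> R by rewrite expf_neq0// pnatr_eq0 -lt0n.
have falling j : (j <= tau)%N ->
    \sum_(y in C) (falling_poly R j).[(n - hamming_dist x y)%:R] =
    #|C|%:R * ((q%:R ^+ n)^-1 * \sum_(0 <= z < n.+1)
      'C(n, z)%:R * (q%:R - 1) ^+ z * (falling_poly R j).[(n - z)%:R]).
  (* The factor [q ^ j] makes both sums natural numbers given by the moment lemmas. *)
  move=> jtau; apply: (mulIf (qn0 j)).
  have -> : (\sum_(y in C) (falling_poly R j).[(n - hamming_dist x y)%:R]) *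
      q%:R ^+ j = ('C(n, j) * #|C| * j`!)%:R.
    rewrite -(design_binomial_moment x Cd) ?jtau// mulr_suml big_distrl natr_sum.
    apply: eq_bigr => y _.
    by rewrite horner_falling_poly -bin_ffact -natrX -natrM mulnAC.
  rewrite -mulrA -mulrA.
  have -> : (\sum_(0 <= z < n.+1) 'C(n, z)%:R * (q%:R - 1) ^+ z *
      (falling_poly R j).[(n - z)%:R]) * q%:R ^+ j = ('C(n, j) * q ^ n * j`!)%:R.
    rewrite -(hamming_binomial_moment q0 (leq_trans jtau taun)).
    rewrite mulr_suml big_distrl natr_sum; apply: eq_bigr => z _ /=.
    rewrite horner_falling_poly -bin_ffact -(natrB _ q0) -!natrX -!natrM.
    by congr (_%:R); rewrite !mulnA mulnAC.
  by rewrite !natrM natrX; field; exact: qn0.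
(* The size bound is generalized to any [m <= tau.+1] for the induction. *)
move=> sp; move: {-2}tau.+1 (leqnn tau.+1) sp => m; elim: m p => [|m IHm] p mtau.
  rewrite size_poly_leq0 => /eqP ->.
  rewrite [LHS]big1 ?[X in _ * (_ * X)]big1 ?mulr0// => z _; rewrite horner0 ?mulr0//.
move=> sp; pose r := p - p`_m *: falling_poly R m.
have pE : p = r + p`_m *: falling_poly R m by rewrite subrK.
have sr : (size r <= m)%N.
  apply/leq_sizeP => i mi; rewrite coefB coefZ.
  have [<-|mi'] := eqVneq m i.
    have /monicP := falling_poly_monic R m.
    by rewrite /lead_coef size_falling_poly/= => ->; rewrite mulr1 subrr.
  have {}mi : (m < i)%N by rewrite ltn_neqAle mi'.
  rewrite (nth_default 0 (leq_trans sp mi)).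
  by rewrite [(falling_poly R m)`_i]nth_default ?size_falling_poly// mulr0 subrr.
have hE (s : R) : p.[s] = r.[s] + p`_m * (falling_poly R m).[s].
  by rewrite {1}pE !hornerE.
under eq_bigr do rewrite hE.
rewrite big_split/= (IHm r (ltnW mtau) sr) -mulr_sumr falling//.
under [in RHS]eq_bigr do rewrite hE mulrDr mulrCA.
by rewrite big_split/= -mulr_sumr !mulrDr; congr (_ + _); ring.
Qed.

(** * Inner products and the energy bound for designs *)

Lemma hamming_dist_le (n q : nat) (x y : hamming_space n q) :
  (hamming_dist x y <= n)%N.
Proof. by rewrite -[X in (_ <= X)%N]card_ord max_card. Qed.

Lemma hamming_ip_id (R : realType) (n q : nat) (x : hamming_space n q) :
  hamming_ip R x x = 1.
Proof.
rewrite /hamming_ip /hamming_dist eq_card0 ?mulr0 ?mul0r ?subr0// => i.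
by rewrite inE eqxx.
Qed.

Lemma hamming_ip_itv (R : realType) (n q : nat) (x y : hamming_space n q) :
  x != y -> hamming_ip R x y \in `[-1, 1[.
Proof.
move=> xy; have d0 : (0 < hamming_dist x y)%N.
  rewrite lt0n; apply: contra xy => /eqP /card0_eq d0; apply/eqP/ffunP => i.
  by apply/eqP; have := d0 i; rewrite inE => /negbFE.
have n0 : (0 < n)%N := leq_trans d0 (hamming_dist_le x y).
have dn : (hamming_dist x y)%:R <= n%:R :> R by rewrite ler_nat hamming_dist_le.
have ub : 2 * (hamming_dist x y)%:R / n%:R <= 2 :> R.
  by rewrite ler_pdivrMr ?ltr0n// ler_pM2l.
have lb : 0 < 2 * (hamming_dist x y)%:R / n%:R :> R.
  by rewrite divr_gt0 ?mulr_gt0 ?ltr0n.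
by rewrite in_itv/= /hamming_ip; apply/andP; split; lra.
Qed.

Lemma design_sum (R : realType) (n q tau : nat) (C : {set hamming_space n q})
    (x : hamming_space n q) (f : {poly R}) :
  tau_design tau C -> (0 < n)%N -> (1 < q)%N -> (size f <= tau.+1)%N ->
  \sum_(y in C) f.[hamming_ip R x y] = #|C|%:R * krawtchouk0 n q f.
Proof.
move=> Cd n0 q1 sf.
have q0 : (0 < q)%N := ltnW q1.
(* A design has at least [q ^ tau] of the [q ^ n] words. *)
have taun : (tau <= n)%N.
  have [lambda [l0 CE _]] := Cd.
  rewrite -(leq_exp2l _ _ q1) (@leq_trans #|C|) ?CE ?leq_pmull// -CE.
  by rewrite (leq_trans (max_card _))// card_ffun !card_ord.
have nR : n%:R != 0 :> R by rewrite pnatr_eq0 -lt0n.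
(* [g] sends the number [n - z] of agreeing coordinates to [1 - 2z/n]; having degree one, it
   preserves the degree of [f] under composition. *)
pose g : {poly R} := (2 / n%:R) *: 'X + (-1)%:P.
have sg : size g = 2%N.
  rewrite size_polyDl size_scale ?size_polyX ?mulf_neq0 ?invr_neq0 ?pnatr_eq0 -?lt0n//.
  by rewrite size_polyC oppr_eq0 oner_eq0.
have fE z : (z <= n)%N -> f.[1 - 2 * z%:R / n%:R] = (f \Po g).[(n - z)%:R].
  move=> zn; rewrite horner_comp; congr (f.[_]).
  by rewrite !hornerE natrB//; field.
rewrite /krawtchouk0 [in RHS]big_nat.
under [in RHS]eq_bigr => z /andP[_ zn] do rewrite fE//.
rewrite -big_nat -(design_poly_moment x Cd)// ?size_comp_poly2//.
by apply: eq_bigr => y _; rewrite -fE// hamming_dist_le.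
Qed.

(** For each codeword [x], [design_sum] evaluates the sum of [f] over the code. Its term [y = x] is
    [f(1)], and the others are at most those of [h]. *)
Lemma design_energy_ge (R : realType) (n q tau : nat)
    (C : {set hamming_space n q}) (h : R -> R) (f : {poly R}) :
  tau_design tau C -> (0 < n)%N -> (1 < q)%N -> (size f <= tau.+1)%N ->
  (forall t : R, t \in `[-1, 1[ -> f.[t] <= h t) ->
  krawtchouk0 n q f * #|C|%:R - f.[1] <= energy C h.
Proof.
move=> Cd n0 q1 sf fh.
have C0 : 0 < #|C|%:R :> R.
  by have [l [l0 -> _]] := Cd; rewrite ltr0n muln_gt0 l0 expn_gt0 (ltnW q1).
rewrite /energy ler_pdivlMl//.
have -> : #|C|%:R * (krawtchouk0 n q f * #|C|%:R - f.[1]) =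
    \sum_(x in C) (#|C|%:R * krawtchouk0 n q f - f.[1]).
  by rewrite sumr_const [krawtchouk0 _ _ _ * _]mulrC mulr_natl.
apply: ler_sum => x xC.
rewrite -(design_sum x Cd)// (bigD1 x)//= hamming_ip_id [f.[1] + _]addrC addrK.
rewrite [leLHS](eq_bigl (fun y => (y \in C) && (x != y))); last first.
  by move=> y; rewrite eq_sym.
by apply: ler_sum => y /andP[_ xy]; exact/fh/hamming_ip_itv.
Qed.

(** * The extremal polynomial and the linear program *)

(** [A] lists all nodes and [B] those met to first order. The sign condition stays a hypothesis
    because odd and even [tau] satisfy it in different ways. *)
Lemma absolutely_monotone_hermite (R : realType) (h : R -> R) (A B : seq R) :
  absolutely_monotone h ->
  uniq A -> uniq B -> {subset B <= A} -> (0 < size A)%N ->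
  {in A, forall z, z \in `[-1, 1[} ->
  (forall t, t \in `[-1, 1[ ->
     0 <= \prod_(z <- A) (t - z) * \prod_(z <- B) (t - z)) ->
  exists f : {poly R}, [/\ (size f <= size A + size B)%N,
    {in A, forall z, f.[z] = h z}
    & forall t, t \in `[-1, 1[ -> f.[t] <= h t].
Proof.
case=> g [g0 gd g_ge0] uA uB BA A0 Aab w_ge0.
have [f [sf fA fB]] := hermite_interpolant (g 0%N) (g 1%N) uA uB BA.
exists f; split=> // [z zA|t tab]; first by rewrite fA// g0// Aab.
rewrite -g0//; apply: (@hermite_interpolant_le _ (-1) 1 g A B) => //.
- by move=> m; exact: has_derivative_on_continuous (gd m).
- move=> m z zab; apply: has_derivative_on_is_derive (gd m).
  apply: filterS (near_in_itvoo zab) => y /=.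
  by rewrite !in_itv/= => /andP[/ltW -> ->].
- exact: w_ge0.
Qed.

(* The quadrature rule turns [f_0 M - f(1)] into [M * \sum_i w_i f(x_i)] with
   positive weights, so a polynomial [f <= h] meeting [h] at all the nodes
   maximizes it. *)
Lemma levenshtein_lp_max (R : realType) (n q M tau m : nat) (h : R -> R)
    (node weight : 'I_m -> R) :
  (0 < M)%N -> (forall i, 0 < weight i) ->
  (forall i, node i \in `[-1, 1[) ->
  levenshtein_quadrature n q M tau node weight ->
  (exists f : {poly R}, [/\ (size f <= tau.+1)%N,
    forall i, f.[node i] = h (node i)
    & forall t, t \in `[-1, 1[ -> f.[t] <= h t]) ->
  is_maximum (lp_values n q M tau h) (M%:R * \sum_(i < m) weight i * h (node i)).
Proof.
move=> M0 w_gt0 node_itv quad [f [sf fnode fh]].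
have valE (p : {poly R}) : (size p <= tau.+1)%N ->
    krawtchouk0 n q p * M%:R - p.[1] = M%:R * \sum_(i < m) weight i * p.[node i].
  move=> sp; rewrite (quad p sp) mulrDl divfK ?pnatr_eq0 -?lt0n//.
  by rewrite addrC addKr mulrC.
split.
  exists f => //; rewrite valE//; congr (_ * _).
  by apply: eq_bigr => i _; rewrite fnode.
move=> _ [p [sp ph] <-]; rewrite valE// ler_pM2l ?ltr0n//.
by apply: ler_sum => i _; rewrite ler_pM2l// ph.
Qed.

Lemma lp_value_le_min_design_energy (R : realType) (n q M tau : nat)
    (h : R -> R) (v : R) :
  (0 < n)%N -> (1 < q)%N -> lp_values n q M tau h v ->
  (v%:E <= min_design_energy n q M tau h)%E.
Proof.
(* The default [+oo] of the minimum lies above every real value. *)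
move=> n0 q1 [f [sf fh] <-]; apply: le_bigmin; first exact: leey.
move=> C /andP[/asboolP Cd /eqP <-]; rewrite lee_fin.
exact: design_energy_ge Cd n0 q1 sf fh.
Qed.


Lemma incr_inj (R : realType) (m : nat) (u : 'I_m -> R) :
  {homo u : i j / (i < j)%N >-> i < j} -> injective u.
Proof.
move=> u_lt i j uij; apply/val_inj/eqP; case: ltngtP => // /u_lt.
  by rewrite uij ltxx.
by rewrite uij ltxx.
Qed.

Theorem theorem4p1 (R : realType) (n tau q M : nat) (h : R -> R)
    (n_gt0 : (0 < n)%N) (tau_gt0 : (0 < tau)%N) (q_ge2 : (2 <= q)%N)
    (h_gt0 : forall t : R, t \in `[-1, 1[ -> 0 < h t)
    (h_am : absolutely_monotone h)
    (M_rao : (rao_bound n q tau < M <= rao_bound n q tau.+1)%N) :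
  (forall (k : nat) (alpha rho : 'I_k -> R),
     tau = (2 * k - 1)%N -> levenshtein_odd n q M alpha rho ->
     ((M%:R * \sum_(i < k) rho i * h (alpha i))%:E
        <= min_design_energy n q M tau h)%E /\
     ((min_design_energy n q M tau h < +oo)%E ->
      is_maximum (lp_values n q M tau h)
        (M%:R * \sum_(i < k) rho i * h (alpha i)))) /\
  (forall (k : nat) (beta gamma : 'I_k.+1 -> R),
     tau = (2 * k)%N -> levenshtein_even n q M beta gamma ->
     ((M%:R * \sum_(i < k.+1) gamma i * h (beta i))%:E
        <= min_design_energy n q M tau h)%E /\
     ((min_design_energy n q M tau h < +oo)%E ->
      is_maximum (lp_values n q M tau h)
        (M%:R * \sum_(i < k.+1) gamma i * h (beta i)))).
Proof.
have M0 : (0 < M)%N by case/andP: M_rao => /(leq_ltn_trans (leq0n _)).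
split=> [k alpha rho tauE [alpha_itv alpha_lt rho_gt0 quad]
        |k beta gamma tauE [beta0 beta_lt1 beta_lt gamma_gt0 quad]].
(* For [k = 0] the truncated [2 * k - 1] would make [tau] zero. *)
- have k0 : (0 < k)%N.
    by case: k tauE tau_gt0 {alpha rho alpha_itv alpha_lt rho_gt0 quad} => // ->.
  have alpha_itv' i : alpha i \in `[-1, 1[.
    by rewrite in_itv/=; have /andP[/ltW -> ->] := alpha_itv i.
  have alpha_inj : injective alpha := incr_inj alpha_lt.
  (* An attained maximum is itself a value of the program, hence a lower bound for the energy. *)
  suff lp : is_maximum (lp_values n q M tau h)
      (M%:R * \sum_(i < k) rho i * h (alpha i)).
    by split=> // ; apply: lp_value_le_min_design_energy => //; case: lp.
  apply: levenshtein_lp_max => //; first by rewrite tauE.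
  have uA : uniq (codom alpha) by rewrite map_inj_uniq// enum_uniq.
  (* Every node is doubled, so the product is a square and the size is at most [2 * k = tau.+1]. *)
  have [||t _|f [sf fA fh]] :=
      absolutely_monotone_hermite h_am uA uA (fun=> id).
  + by rewrite size_codom card_ord.
  + by move=> z /codomP[i ->].
  + by rewrite -expr2 sqr_ge0.
  exists f; split=> // [|i]; last by rewrite fA// codom_f.
  by rewrite (leq_trans sf)// size_codom card_ord tauE; lia.
- have beta_itv i : beta i \in `[-1, 1[.
    rewrite in_itv/= beta_lt1 andbT -beta0.
    have [->//|i0] := eqVneq i ord0.
    by rewrite ltW// beta_lt// lt0n.
  have beta_inj : injective beta := incr_inj beta_lt.
  suff lp : is_maximum (lp_values n q M tau h)
      (M%:R * \sum_(i < k.+1) gamma i * h (beta i)).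
    by split=> // ; apply: lp_value_le_min_design_energy => //; case: lp.
  apply: levenshtein_lp_max => //; first by rewrite tauE.
  have uA : uniq (codom beta) by rewrite map_inj_uniq// enum_uniq.
  (* Only [beta ord0 = -1] stays simple: its factor [t + 1] is nonnegative, the rest is a square,
     and the size is at most [k.+1 + k = tau.+1]. *)
  pose B := codom (beta \o lift ord0).
  have uB : uniq B by rewrite map_inj_uniq ?enum_uniq//;
    apply: inj_comp; last exact: lift_inj.
  have BA : {subset B <= codom beta} by move=> _ /codomP[i ->]; exact: codom_f.
  have [||t tab|f [sf fA fh]] := absolutely_monotone_hermite h_am uA uB BA.
  + by rewrite size_codom card_ord.
  + by move=> z /codomP[i ->].
  + rewrite !big_image/= big_ord_recl beta0 -mulrA mulr_ge0//.
      by move: tab; rewrite in_itv/= => /andP[t1 _]; rewrite subr_ge0.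
    by rewrite -expr2 sqr_ge0.
  exists f; split=> // [|i]; last by rewrite fA// codom_f.
  by rewrite (leq_trans sf)// !size_codom !card_ord tauE; lia.
Qed.
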